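(* There is an absolute constant $C>0$ with the following property. Let $G$ be a locally compact group and let $f\in B(G)$ be integer-valued with $\|f\|_{B(G)}\le\gamma$. Then there exist open subgroups $H_1,\dots,H_L\le G$, elements $a_1,\dots,a_L\in G$, and signs $\sigma_i\in\{-1,1\}$, with repetitions allowed, such that $$f=\sum_{i=1}^{L}\sigma_i\mathbf 1_{a_iH_i},\qquad L\le 2^{C\gamma^4}.$$
   Context: $B(G)$ denotes the Fourier–Stieltjes algebra of the locally compact group $G$: the set of coefficient functions $f(g)=\langle\pi(g)\xi,\eta\rangle$ of strongly continuous unitary representations $\pi$ of $G$ on complex Hilbert spaces, with $\|f\|_{B(G)}$ the infimum of $\|\xi\|\,\|\eta\|$ over all such representations of $f$. $\mathbf 1_S$ denotes the indicator function of $S\subseteq G$. *)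

(* Defs.v *)
From HB Require Import structures.
From mathcomp Require Import all_boot all_order all_algebra.
From mathcomp Require Import all_classical all_reals all_analysis.
From mathcomp Require Import complex.

Set Implicit Arguments.
Unset Strict Implicit.
Unset Printing Implicit Defensive.

Import Order.TTheory GRing.Theory Num.Theory.
Import numFieldNormedType.Exports.

Local Open Scope classical_set_scope.
Local Open Scope complex_scope.
Local Open Scope ring_scope.

HB.structure Definition PreTopologicalGroup :=
  {G of Topological G & Group G}.

HB.mixin Record PreTopologicalGroup_isTopologicalGroup G
    & PreTopologicalGroup G := {
  mulg_continuous : continuous (fun x : G * G => (x.1 * x.2)%g) ;
  invg_continuous : continuous (fun x : G => (x^-1)%g)
}.

#[short(type="topologicalGroupType")]
HB.structure Definition TopologicalGroup :=
  {G of PreTopologicalGroup G & PreTopologicalGroup_isTopologicalGroup G}.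

(* The inner product is linear in its first argument and conjugate-linear in
   its second.  The norm of a normed module over R[i] has values in R[i]. *)
HB.mixin Record NormedModule_isInner (R : realType) H
    & NormedModule R[i] H := {
  inner : {dot H for @Num.conj R[i]} ;
  inner_normE : forall x : H, `|x| ^+ 2 = inner x x
}.

#[short(type="hilbertType")]
HB.structure Definition Hilbert (R : realType) :=
  {H of CompleteNormedModule R[i] H & NormedModule_isInner R H}.

Record unitary_rep (R : realType) (G : topologicalGroupType)
    (H : hilbertType R) (pi : G -> {linear H -> H}) : Prop := {
  rep_bij : forall g, bijective (pi g) ;
  rep_inner : forall g (x y : H), inner (pi g x) (pi g y) = inner x y ;
  rep1 : forall x : H, pi 1%g x = x ;
  repM : forall g h (x : H), pi (g * h)%g x = pi g (pi h x) ;
  rep_strong : forall x : H, continuous (fun g => pi g x)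
}.

(* The products of norms |xi| |eta| over all the representations of f as a
   coefficient function g |-> <pi(g) xi, eta>. *)
Definition coefficient_norms (R : realType) (G : topologicalGroupType)
    (f : G -> R[i]) : set R :=
  [set r | exists (H : hilbertType R) (pi : G -> {linear H -> H}) (xi eta : H),
     [/\ unitary_rep pi,
         forall g, f g = inner (pi g xi) eta &
         r%:C = `|xi| * `|eta|]].

Definition fourier_stieltjes (R : realType) (G : topologicalGroupType) :
    set (G -> R[i]) :=
  [set f | exists (H : hilbertType R) (pi : G -> {linear H -> H}) (xi eta : H),
     unitary_rep pi /\ forall g, f g = inner (pi g xi) eta].

Definition fourier_stieltjes_norm (R : realType) (G : topologicalGroupType)
    (f : G -> R[i]) : R := inf (coefficient_norms f).

Definition subgroup (G : topologicalGroupType) (H : set G) : Prop :=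
  group_closed [in H].

Definition left_coset (G : topologicalGroupType) (a : G) (H : set G) : set G :=
  [set (a * h)%g | h in H].

(* Main.v *)
(* Write [f g = <pi(g) xi, eta>] with [|xi|^2, |eta|^2 <= c] and [c] an integer
   slightly larger than gamma, and decompose by induction on [|eta|^2], keeping
   [xi] fixed and allowing [f] to be only close to an integer-valued function [F].
   Let [S] be the open subgroup of all [h] with [F(h g) = F(g)].  If [F] is
   supported on few cosets [S y], it is a short sum of cosets.  Otherwise there
   are many inequivalent [y_i] with [F(y_i) <> 0], and the vectors
   [v_i = pi(y_i)^-1 eta] are separated, since the integers [F(y_i x)] tell them
   apart.  A set [A] of indices maximising [ln #|A|] minus a multiple of the
   variance of [v] on [A] cannot be split: for each [x], the integers [F(y_i x)]
   agree for nearly all [i] in [A].  Hence [w], the average of [v] over [A], is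
   again almost integer, and both [w] and [v_i - w], for a suitable [i], have
   norm squared at most [|eta|^2 - 1/(32c)].  The error at most doubles in each of
   the 32c^2 steps, so it has to start at about 2^(-32c^2); this makes the number
   of cosets needed in one step 2^O(c^4). *)
Require Import Defs.
From mathcomp Require Import all_boot all_order all_algebra.
From mathcomp Require Import all_classical all_reals all_analysis.
From mathcomp Require Import complex.
From mathcomp Require Import ring lra zify.

Set Implicit Arguments.
Unset Strict Implicit.
Unset Printing Implicit Defensive.

Import Order.TTheory GRing.Theory Num.Theory.
Import numFieldNormedType.Exports.

Local Open Scope classical_set_scope.
Local Open Scope complex_scope.
Local Open Scope ring_scope.

(** * Real inner product geometry: Cauchy-Schwarz, averages, variance *)

Section RealInner.
Variables (R : realType) (H : hilbertType R).
Implicit Types (x y z : H) (r : R).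

(* The complex structure plays no role in the argument: [H] is used as a real
   inner product space. *)
Definition redot x y : R := complex.Re (inner x y).

Definition normsq x : R := redot x x.

Definition rscale r x : H := r%:C *: x.

Lemma redotDl x y z : redot (x + y) z = redot x z + redot y z.
Proof. by rewrite /redot linearDl raddfD. Qed.

Lemma redotC x y : redot x y = redot y x.
Proof.
have reconj (z : R[i]) : complex.Re (Num.conj z) = complex.Re z by case: z.
by rewrite /redot hermC expr0 mul1r; exact: reconj.
Qed.

Lemma redotZl r x y : redot (rscale r x) y = r * redot x y.
Proof.
rewrite /redot /rscale linearZl_LR /=.
by case: (inner x y) => a b /=; rewrite mul0r subr0.
Qed.

Lemma redotDr x y z : redot z (x + y) = redot z x + redot z y.
Proof. by rewrite redotC redotDl !(redotC z). Qed.

Lemma redotZr r x y : redot y (rscale r x) = r * redot y x.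
Proof. by rewrite redotC redotZl redotC. Qed.

Lemma redotNl x y : redot (- x) y = - redot x y.
Proof. by rewrite /redot linearNl raddfN. Qed.

Lemma redotNr x y : redot y (- x) = - redot y x.
Proof. by rewrite redotC redotNl redotC. Qed.

Lemma redot_suml (I : finType) (A : {set I}) (v : I -> H) x :
  redot (\sum_(i in A) v i) x = \sum_(i in A) redot (v i) x.
Proof. 
rewrite /redot linear_sumlz /=.
by rewrite raddf_sum.
Qed.

Lemma normsq_norm x : (normsq x)%:C = `|x| ^+ 2.
Proof.
rewrite inner_normE /normsq /redot.
have : 0 <= inner x x by rewrite -inner_normE exprn_ge0.
by case: (inner x x) => a b; rewrite lecE /= => /andP[/eqP -> _].
Qed.

Lemma normsq_ge0 x : 0 <= normsq x.
Proof.
by have := exprn_ge0 2 (normr_ge0 x); rewrite -normsq_norm lecR.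
Qed.

Lemma normsqD x y : normsq (x + y) = normsq x + 2 * redot x y + normsq y.
Proof. by rewrite /normsq redotDl !redotDr (redotC y x); ring. Qed.

Lemma normsqN x : normsq (- x) = normsq x.
Proof. by rewrite /normsq redotNl redotNr opprK. Qed.

Lemma normsqB x y : normsq (x - y) = normsq x - 2 * redot x y + normsq y.
Proof. by rewrite normsqD redotNr normsqN; ring. Qed.

Lemma normsqZ r x : normsq (rscale r x) = r ^+ 2 * normsq x.
Proof. by rewrite /normsq redotZl redotZr; ring. Qed.

Lemma redot_sqr_le x y : redot x y ^+ 2 <= normsq x * normsq y.
Proof.
have h t : 0 <= normsq x - 2 * t * redot x y + t ^+ 2 * normsq y.
  by have := normsq_ge0 (x - rscale t y); rewrite normsqB normsqZ redotZr mulrA.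
have [y0|y0] := eqVneq (normsq y) 0.
  have [->|xy0] := eqVneq (redot x y) 0.
    by rewrite expr0n mulr_ge0 // normsq_ge0.
  (* With [normsq y = 0] the expression in [h] is affine in [t]; this [t] makes it [- normsq x - 2],
     which is negative. *)
  have := h ((normsq x + 1) / redot x y).
  rewrite y0 mulr0 addr0 -mulrA divfK //.
  by have := normsq_ge0 x; lra.
have yp : 0 < normsq y by rewrite lt_def y0 normsq_ge0.
have := h (redot x y / normsq y).
set a := redot x y; set b := normsq y => hh.
have -> : a ^+ 2 = (2 * (a / b) * a - (a / b) ^+ 2 * b) * b by field.
by rewrite ler_wpM2r ?(ltW yp) //; move: hh; rewrite -/a -/b; lra.
Qed.

Definition average {I : finType} (v : I -> H) (A : {set I}) : H :=
  rscale (#|A|%:R^-1) (\sum_(i in A) v i).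

(** This is [#|A|] times the variance; left unnormalised, it is superadditive on disjoint unions. *)
Definition spread {I : finType} (v : I -> H) (A : {set I}) : R :=
  \sum_(i in A) normsq (v i - average v A).

Lemma redot_average (I : finType) (v : I -> H) (A : {set I}) x :
  redot x (average v A) = #|A|%:R^-1 * \sum_(i in A) redot x (v i).
Proof.
rewrite redotZr redotC redot_suml; congr (_ * _).
by apply: eq_bigr => i _; rewrite redotC.
Qed.

Lemma card_redot_average (I : finType) (v : I -> H) (A : {set I}) x :
  (0 < #|A|)%N ->
  #|A|%:R * redot x (average v A) = \sum_(i in A) redot x (v i).
Proof.
move=> A0; rewrite redot_average mulrA divff ?mul1r //.
by rewrite pnatr_eq0 -lt0n.
Qed.

(* Huygens' parallel axis identity *)
Lemma sum_normsqB (I : finType) (v : I -> H) (A : {set I}) z :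
  (0 < #|A|)%N ->
  \sum_(i in A) normsq (v i - z) =
  spread v A + #|A|%:R * normsq (average v A - z).
Proof.
move=> A0; rewrite /spread; set w := average v A.
rewrite -sum1_card natr_sum mulr_suml -big_split /=.
have e i : normsq (v i - z) = 
    (normsq (v i - w) + 1 * normsq (w - z)) +
    2 * (redot (w - z) (v i) - redot (w - z) w).
  have -> : v i - z = (v i - w) + (w - z) by rewrite addrA subrK.
  rewrite normsqD (redotC (v i - w)) redotDr redotNr; ring.
rewrite (eq_bigr _ (fun i _ => e i)) big_split /= -mulr_sumr sumrB.
rewrite -card_redot_average // -/w sumr_const.
by rewrite -[redot _ _ *+ _]mulr_natl subrr mulr0 addr0.
Qed.

Lemma spread_ge0 (I : finType) (v : I -> H) (A : {set I}) : 0 <= spread v A.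
Proof. by apply: sumr_ge0 => i _; exact: normsq_ge0. Qed.

(** The parallel axis identity at the origin. On a sphere, a large spread forces a short average,
    and conversely. *)
Lemma spreadE (I : finType) (v : I -> H) (A : {set I}) (E : R) :
  (0 < #|A|)%N -> (forall i, normsq (v i) = E) ->
  spread v A = #|A|%:R * (E - normsq (average v A)).
Proof.
move=> A0 vE; have := @sum_normsqB I v A 0 A0.
under eq_bigr do rewrite subr0 vE.
rewrite sumr_const subr0 -[_ *+ _]mulr_natl mulrBr => ->; ring.
Qed.

Lemma redot_average_ge (I : finType) (v : I -> H) (A : {set I}) x r :
  (0 < #|A|)%N -> (forall i, i \in A -> r <= redot x (v i)) ->
  r <= redot x (average v A).
Proof.
move=> A0 h; rewrite -(ler_pM2l (_ : 0 < #|A|%:R)) ?ltr0n //.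
rewrite card_redot_average // mulr_natl -sumr_const.
by apply: ler_sum.
Qed.

Lemma redot_average_le (I : finType) (v : I -> H) (A : {set I}) x r :
  (0 < #|A|)%N -> (forall i, i \in A -> redot x (v i) <= r) ->
  redot x (average v A) <= r.
Proof.
move=> A0 h; rewrite -(ler_pM2l (_ : 0 < #|A|%:R)) ?ltr0n //.
rewrite card_redot_average // mulr_natl -sumr_const.
by apply: ler_sum.
Qed.

End RealInner.

(** * Entropy against variance: a subset that cannot be split evenly *)

Section Concentration.
Variable R : realType.

Lemma ln2_bounds : 2^-1 <= ln (2 : R) <= 1.
Proof.
apply/andP; split.
  have -> : ln (2 : R) = - ln (1 + - 2^-1) :> R.
    by rewrite (_ : 1 + - 2^-1 = 2^-1 :> R) ?lnV ?opprK ?posrE //; lra.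
  rewrite lerNr; apply: le_ln1Dx; lra.
have -> : (2 : R) = 1 + 1 by lra.
apply: le_ln1Dx; lra.
Qed.

(** Weight the last two hypotheses by [n1] and [n2] and add them. The variance drop contributes at
    least [n2 * (1 + m)], the entropy at most [n2 + n2 * ln (n / n2)]. Hence [m <= ln (n / n2)], and
    [ln 2 <= 1] turns this into a power of 2. *)
Lemma small_part (c m n1 n2 : nat) (W W1 W2 : R) :
  (0 < c)%N -> (0 < n1)%N -> (0 < n2)%N ->
  let n := (n1 + n2)%N in
  let tau := 4 * c%:R * (1 + m%:R) : R in
  W1 + W2 + n2%:R / (4 * c%:R) <= W ->
  ln n1%:R - tau * W1 / n1%:R <= ln n%:R - tau * W / n%:R ->
  ln n2%:R - tau * W2 / n2%:R <= ln n%:R - tau * W / n%:R ->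
  (n2 * 2 ^ m <= n)%N.
Proof.
move=> c0 n10 n20 n tau hW h1 h2.
have c0R : 0 < c%:R :> R by rewrite ltr0n.
have n1R : 0 < n1%:R :> R by rewrite ltr0n.
have n2R : 0 < n2%:R :> R by rewrite ltr0n.
have nE : n%:R = n1%:R + n2%:R :> R by rewrite natrD.
have nR : 0 < n%:R :> R by rewrite nE addr_gt0.
have tau0 : 0 <= tau by rewrite !mulr_ge0 // addr_ge0.
have key : tau * (W - W1 - W2) <=
   n1%:R * (ln n%:R - ln n1%:R) + n2%:R * (ln n%:R - ln n2%:R).
  have e1 : n1%:R * (ln n1%:R - tau * W1 / n1%:R) + tau * W1 =
      n1%:R * ln n1%:R :> R.
    by field; rewrite lt0r_neq0.
  have e2 : n2%:R * (ln n2%:R - tau * W2 / n2%:R) + tau * W2 =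
      n2%:R * ln n2%:R :> R.
    by field; rewrite lt0r_neq0.
  have e3 : (n1%:R + n2%:R) * (ln n%:R - tau * W / n%:R) + tau * W =
      (n1%:R + n2%:R) * ln n%:R :> R.
    by rewrite -nE; field; rewrite lt0r_neq0.
  have i1 := ler_wpM2l (ltW n1R) h1.
  have i2 := ler_wpM2l (ltW n2R) h2.
  by lra.
have low : n2%:R * (1 + m%:R) <= tau * (W - W1 - W2).
  have -> : n2%:R * (1 + m%:R) = tau * (n2%:R / (4 * c%:R)) :> R.
    by rewrite /tau; field; rewrite lt0r_neq0.
  by apply: ler_wpM2l => //; lra.
have big : n1%:R * (ln n%:R - ln n1%:R) <= n2%:R :> R.
  rewrite -ln_div ?posrE //.
  have -> : n%:R / n1%:R = 1 + n2%:R / n1%:R :> R.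
    by rewrite nE; field; rewrite lt0r_neq0.
  have q0 : 0 < n2%:R / n1%:R :> R by rewrite divr_gt0.
  rewrite mulrC -ler_pdivlMr //; apply: le_ln1Dx; lra.
have hm : m%:R <= ln n%:R - ln n2%:R :> R.
  rewrite -(ler_pM2l n2R); lra.
rewrite -(ler_nat R) natrM natrX -ler_ln ?posrE ?mulr_gt0 ?exprn_gt0 //.
rewrite lnM ?posrE ?exprn_gt0 // lnXn //.
have /andP[_ l2] := ln2_bounds.
have : ln (2 : R) *+ m <= m%:R by rewrite -[ln _ *+ _]mulr_natl ler_piMr.
lra.
Qed.

Variable H : hilbertType R.
Variables (I : finType) (v : I -> H).
Implicit Types A B : {set I}.

(** The parallel axis identity on each part leaves the squared distances of the two partial averages
    from [w] as the drop. These averages differ by at least 3/4 in direction [u], so by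
    Cauchy-Schwarz the squares add up to at least [9 / (32 c)]. *)
Lemma spread_split (c k : nat) A1 A2 (u : H) (s : R) :
  (0 < c)%N -> normsq u <= c%:R -> A1 :&: A2 = finset.set0 ->
  (0 < #|A1|)%N -> (0 < #|A2|)%N -> (k <= #|A1|)%N -> (k <= #|A2|)%N ->
  (forall i, i \in A1 -> s + 3 / 4 <= redot u (v i)) ->
  (forall i, i \in A2 -> redot u (v i) <= s) ->
  spread v A1 + spread v A2 + k%:R / (4 * c%:R) <= spread v (A1 :|: A2).
Proof.
move=> c0 uc dA A10 A20 kA1 kA2 h1 h2.
have c0R : 0 < c%:R :> R by rewrite ltr0n.
rewrite [in leRHS]/spread; set w := average v _.
rewrite (eq_bigl [predU A1 & A2]); last by move=> i; rewrite !inE.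
rewrite bigU /=; last by rewrite -finset.setI_eq0 dA.
rewrite !sum_normsqB //.
set w1 := average v A1; set w2 := average v A2.
have m1 : s + 3 / 4 <= redot u w1 by apply: redot_average_ge.
have m2 : redot u w2 <= s by apply: redot_average_le.
have b x : redot u x ^+ 2 <= c%:R * normsq x.
  by apply: le_trans (redot_sqr_le u x) _; rewrite ler_wpM2r ?normsq_ge0.
have b1 := b (w1 - w); have b2 := b (w2 - w).
have d1 : k%:R * normsq (w1 - w) <= #|A1|%:R * normsq (w1 - w).
  by rewrite ler_wpM2r ?normsq_ge0 ?ler_nat.
have d2 : k%:R * normsq (w2 - w) <= #|A2|%:R * normsq (w2 - w).
  by rewrite ler_wpM2r ?normsq_ge0 ?ler_nat.
have key : (4 * c%:R)^-1 <= normsq (w1 - w) + normsq (w2 - w).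
  rewrite -(ler_pM2l c0R) invfM mulrCA divff ?lt0r_neq0 // mulr1 mulrDr.
  rewrite !redotDr !redotNr in b1 b2.
  have ab : (3 / 4) ^+ 2 <= (redot u w1 - redot u w2) ^+ 2.
    by rewrite ler_sqr ?nnegrE; lra.
  (* This is [2 (a^2 + b^2) = (a - b)^2 + (a + b)^2] for the components [a], [b] of [w1 - w] and
     [w2 - w] along [u]. *)
  have := sqr_ge0 (redot u w1 + redot u w2 - 2 * redot u w); lra.
have := ler_wpM2l (ler0n R k) key; lra.
Qed.

Lemma concentrated_subset (c m : nat) :
  (0 < c)%N -> (forall i, normsq (v i) <= c%:R) ->
  (2 ^ (1 + 8 * c ^ 2 * (1 + m)) <= #|I|)%N ->
  exists A, (1 < #|A|)%N /\ forall u s A1 A2,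
    normsq u <= c%:R -> A1 :|: A2 = A -> A1 :&: A2 = finset.set0 ->
    (forall i, i \in A1 -> s + 3 / 4 <= redot u (v i)) ->
    (forall i, i \in A2 -> redot u (v i) <= s) ->
    (minn #|A1| #|A2| * 2 ^ m <= #|A|)%N.
Proof.
move=> c0 vc cI; set tau := 4 * c%:R * (1 + m%:R) : R.
(* The factor [tau] makes a drop of [k / (4 c)] in spread worth [k * (1 + m)]. *)
pose Psi A := ln #|A|%:R - tau * spread v A / #|A|%:R.
have T0 : (0 < #|[set: I]%SET|)%N by rewrite cardsT (leq_trans _ cI) // expn_gt0.
case: (@Order.TotalTheory.arg_maxP _ _ _ [set: I]%SET (fun A => (0 < #|A|)%N) Psi) => //.
move=> A A0 Amax; exists A; rewrite /= in Amax.
have c0R : 0 < c%:R :> R by rewrite ltr0n.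
have tau0 : 0 <= tau by rewrite !mulr_ge0 // addr_ge0.
have AR : 0 < #|A|%:R :> R by rewrite ltr0n.
have TR : 0 < #|[set: I]%SET|%:R :> R by rewrite ltr0n.
split.
  have := Amax _ T0; rewrite /Psi => hmax.
  have h1 : 0 <= tau * spread v A / #|A|%:R.
    by rewrite !mulr_ge0 ?spread_ge0 // invr_ge0 ltW.
  have h2 : tau * spread v [set: I]%SET / #|[set: I]%SET|%:R <= tau * c%:R.
    rewrite -mulrA ler_wpM2l // ler_pdivrMr //.
    have := @sum_normsqB _ _ _ v [set: I]%SET 0 T0.
    under eq_bigr do rewrite subr0.
    have : \sum_(i in [set: I]%SET) normsq (v i) <= c%:R * #|[set: I]%SET|%:R.
      by rewrite mulr_natr -sumr_const; apply: ler_sum.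
    have := mulr_ge0 (ltW TR) (normsq_ge0 (average v [set: I]%SET - 0)); lra.
  (* Here [tau * c = 4 c^2 (1 + m)]; the 8 in the exponent of the size hypothesis pays for
     [ln 2 >= 1/2]. Comparing [A] with the full index set then gives at least two elements. *)
  have h3 : ln 2 + tau * c%:R <= ln #|[set: I]%SET|%:R.
    apply: (@le_trans _ _ (ln (2 ^ (1 + 8 * c ^ 2 * (1 + m)))%:R)).
      rewrite natrX lnXn // -[ln _ *+ _]mulr_natl natrD natrM natrM natrX natrD /tau.
      have /andP[l2 _] := ln2_bounds.
      have : 0 <= 8 * c%:R ^+ 2 * (1 + m%:R) * (ln (2 : R) - 2^-1).
        by apply: mulr_ge0; [rewrite !mulr_ge0 ?exprn_ge0 ?addr_ge0|lra].
      lra.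
    by rewrite ler_ln ?posrE ?ltr0n ?expn_gt0 // ler_nat cardsT.
  have h4 : ln (2 : R) <= ln #|A|%:R by lra.
  by move: h4; rewrite ler_ln ?posrE // ler_nat.
move=> u s A1 A2 uc eA dA h1 h2.
have [A10|A10] := posnP #|A1|; first by rewrite A10 min0n.
have [A20|A20] := posnP #|A2|; first by rewrite A20 minn0.
have cA : #|A| = (#|A1| + #|A2|)%N.
  by rewrite -eA cardsU dA cards0 subn0.
have m1 := Amax _ A10; have m2 := Amax _ A20.
have := @spread_split c (minn #|A1| #|A2|) A1 A2 u s c0 uc dA A10 A20
  (geq_minl _ _) (geq_minr _ _) h1 h2; rewrite eA.
case: (leqP #|A1| #|A2|) => _ hW.
  rewrite cA addnC.
  apply: (@small_part c m _ _ (spread v A) (spread v A2) (spread v A1)) => //.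
  - by rewrite [spread v A2 + _]addrC.
  - by rewrite addnC -cA.
  - by rewrite addnC -cA.
rewrite cA.
apply: (@small_part c m _ _ (spread v A) (spread v A1) (spread v A2)) => //.
- by rewrite -cA.
- by rewrite -cA.
Qed.

End Concentration.

(** * Medians and integer approximation *)

Lemma median (I : finType) (A : {set I}) (F : I -> int) :
  (0 < #|A|)%N -> exists2 i0, i0 \in A &
    (2 * #|[set i in A | (F i < F i0)%R]%SET| <= #|A|)%N /\
    (2 * #|[set i in A | (F i0 < F i)%R]%SET| <= #|A|)%N.
Proof.
move=> /card_gt0P[a aA].
pose above i := [set j in A | F i < F j]%SET.
pose P := [pred i | (i \in A) && (2 * #|above i| <= #|A|)%N].
have [b Pb] : exists b, P b.
  case: (@Order.TotalTheory.arg_maxP _ _ _ a (fun i => i \in A) F aA) => b bA bmax.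
  exists b; rewrite /= bA (_ : above b = finset.set0) ?cards0 ?muln0 //.
  apply/setP => j; rewrite !inE; apply/negbTE/negP => /andP[jA].
  by apply/negP; rewrite -leNgt; exact: bmax.
(* The median is the least value of [F] with at most half of [A] strictly above it. *)
case: (@Order.TotalTheory.arg_minP _ _ _ b P F Pb) => i0 /andP[i0A i0P] i0min.
exists i0 => //; split=> //.
set B := [set _ in _ | _]%SET; rewrite leqNgt; apply/negP => hB.
have /card_gt0P[d dB] : (0 < #|B|)%N.
  by rewrite lt0n; apply/eqP => B0; rewrite B0 muln0 in hB.
case: (@Order.TotalTheory.arg_maxP _ _ _ d (fun i => i \in B) F dB) => j jB jmax.
(* If [B] held more than half of [A], the indices above its largest value would lie outside [B] and
   be fewer than half, against minimality of [i0]. *)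
have : P j.
  move: jB; rewrite !inE => /andP[jA ltj]; rewrite jA /=.
  have dis : B :&: above j = finset.set0.
    apply/setP => l; rewrite finset.in_setI finset.in_set0.
    apply/negbTE/negP => /andP[/jmax /= lj]; rewrite inE ltNge => /andP[_ /negP]; exact.
  have sub : B :|: above j \subset A.
    by apply/fintype.subsetP => l; rewrite !inE => /orP[]/andP[].
  have := subset_leq_card sub; rewrite cardsU dis cards0 subn0; lia.
move/i0min; move: jB; rewrite inE ltNge => /andP[_ /negP]; exact.
Qed.

Lemma sum_indicator (R : realType) (I : finType) (A : {set I}) (b : pred I) :
  \sum_(i in A) (b i)%:R = #|[set i in A | b i]%SET|%:R :> R.
Proof.
rewrite -sum1_card natr_sum big_mkcond /= [RHS]big_mkcond /=.
by apply: eq_bigr => i _; rewrite inE; case: (i \in A); case: (b i).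
Qed.

Lemma near_int_bound (R : realType) (H : hilbertType R) (c : nat) (u x : H)
    (k : int) :
  normsq u <= c%:R -> normsq x <= c%:R -> `|redot u x - k%:~R| < 1 ->
  `|k| <= (c.+1)%:Z.
Proof.
move=> uc xc hk.
have h : redot u x ^+ 2 <= c%:R ^+ 2.
  apply: le_trans (redot_sqr_le _ _) _; rewrite expr2.
  by apply: ler_pM => //; exact: normsq_ge0.
have h' : `|redot u x| <= c%:R.
  by rewrite -(@ler_pXn2r _ 2) ?nnegrE // real_normK ?num_real.
rewrite -ltzD1 -(ltr_int R) intr_norm intrD -pmulrn -natr1.
have := ler_normD (k%:~R - redot u x) (redot u x).
rewrite subrK distrC; lra.
Qed.

(** * Splitting off an almost integer average *)

Section Splitting.
Variables (R : realType) (H : hilbertType R) (I : finType) (v : I -> H).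
Implicit Types A : {set I}.

(** Cutting [A] just below and just above the median value shows that [F] differs from it on at most
    [2 * #|A| / 2^m] indices, each moving the sum by at most [2 K] beyond [eps]. *)
Lemma average_almost_integer (c m K : nat) A (u : H) (F : I -> int) (eps : R) :
  (0 < #|A|)%N -> normsq u <= c%:R -> eps <= 8^-1 ->
  (forall u s A1 A2,
    normsq u <= c%:R -> A1 :|: A2 = A -> A1 :&: A2 = finset.set0 ->
    (forall i, i \in A1 -> s + 3 / 4 <= redot u (v i)) ->
    (forall i, i \in A2 -> redot u (v i) <= s) ->
    (minn #|A1| #|A2| * 2 ^ m <= #|A|)%N) ->
  (forall i, `|redot u (v i) - (F i)%:~R| <= eps) ->
  (forall i, `|F i| <= K%:Z) ->
  exists2 i0, i0 \in A &
    `|redot u (average v A) - (F i0)%:~R| <= eps + (4 * K)%:R / 2 ^+ m.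
Proof.
move=> A0 uc eps8 conc Feps FK.
have [i0 i0A [lo hi]] := median F A0; exists i0 => //.
set B1 := [set _ in _ | _]%SET in lo; set B2 := [set _ in _ | _]%SET in hi.
have thresh (k : int) (B C : {set I}) :
    B = [set i in A | k <= F i]%SET -> C = [set i in A | F i < k]%SET ->
    (minn #|B| #|C| * 2 ^ m <= #|A|)%N /\ #|A| = (#|B| + #|C|)%N.
  move=> eB eC.
  have eA : B :|: C = A.
    apply/setP => i; rewrite eB eC !inE -andb_orr.
    by case: (leP k (F i)); rewrite ?andbT.
  have dA : B :&: C = finset.set0.
    apply/setP => i; rewrite eB eC !inE.
    by case: (leP k (F i)); rewrite ?andbT ?andbF.
  split; last by rewrite -[in LHS]eA cardsU dA cards0 subn0.
  (* With errors at most 1/8, [F i >= k] gives at least [k - 1/8] and [F i < k] at most [k - 7/8]: a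
     gap of exactly 3/4. *)
  apply: (conc u (k%:~R - 7 / 8)) => // i; rewrite ?eB ?eC inE => /andP[iA ki].
  - have : k%:~R <= (F i)%:~R :> R by rewrite ler_int.
    have := Feps i; rewrite ler_norml => /andP[h1 h2]; lra.
  - have : (F i)%:~R <= k%:~R - 1 :> R.
      by rewrite -[1]/(1%:~R) -intrB ler_int; lia.
    have := Feps i; rewrite ler_norml => /andP[h1 h2]; lra.
(* The median decides which side of each cut is the smaller one. *)
have h1 : (#|B1| * 2 ^ m <= #|A|)%N.
  have [h cA] := thresh (F i0) _ B1 erefl erefl.
  by rewrite (minn_idPr _) in h => //; lia.
have h2 : (#|B2| * 2 ^ m <= #|A|)%N.
  have [] := thresh (F i0 + 1) B2 _ _ erefl.
    by apply/setP => i; rewrite !inE lezD1.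
  move=> h cA.
  by rewrite (minn_idPl _) in h => //; lia.
have AR : 0 < #|A|%:R :> R by rewrite ltr0n.
have mR : 0 < 2 ^+ m :> R by rewrite exprn_gt0.
rewrite -(ler_pM2l AR) -[X in X * `|_|](ger0_norm (ltW AR)) -normrM.
have -> : #|A|%:R * (redot u (average v A) - (F i0)%:~R) =
    \sum_(i in A) (redot u (v i) - (F i0)%:~R).
  by rewrite mulrBr card_redot_average // sumrB sumr_const -[_%:~R *+ _]mulr_natl.
apply: le_trans (ler_norm_sum _ _ _) _.
pose bd i : R := eps + (2 * K)%:R * ((F i < F i0)%R%:R + (F i0 < F i)%R%:R).
apply: (@le_trans _ _ (\sum_(i in A) bd i)).
  apply: ler_sum => i _; rewrite /bd.
  have -> : redot u (v i) - (F i0)%:~R =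
     (redot u (v i) - (F i)%:~R) + ((F i)%:~R - (F i0)%:~R) by ring.
  apply: le_trans (ler_normD _ _) _; apply: lerD; first exact: Feps.
  rewrite -intrB -intr_norm.
  case: ltgtP => cmp; rewrite ?addr0 ?add0r ?mulr1 ?mulr0.
  - by rewrite -[(2 * K)%:R]/((2 * K)%:~R) ler_int; have := FK i; have := FK i0; lia.
  - by rewrite -[(2 * K)%:R]/((2 * K)%:~R) ler_int; have := FK i; have := FK i0; lia.
  - by rewrite cmp subrr normr0.
rewrite /bd big_split /= sumr_const -mulr_sumr big_split /= !sum_indicator.
rewrite -[eps *+ _]mulr_natl [leRHS]mulrDr lerD2l -/B1 -/B2.
have b1 : #|B1|%:R <= #|A|%:R / 2 ^+ m :> R.
  by rewrite ler_pdivlMr // -natrX -natrM ler_nat.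
have b2 : #|B2|%:R <= #|A|%:R / 2 ^+ m :> R.
  by rewrite ler_pdivlMr // -natrX -natrM ler_nat.
have := ler_wpM2l (ler0n R K) (lerD b1 b2).
rewrite !natrM; lra.
Qed.

(** Here [w] is the average over a concentrated set and [i0] the index in it closest to [w].
    Separation makes the variance positive, which shortens [w]; the nonzero integers at [x0] keep
    [w] away from 0, which shortens [v i0 - w]. *)
Lemma splitting_vector (X : Type) (u : X -> H) (F : X -> I -> int) (x0 : X)
    (c m : nat) (E eps del : R) :
  (0 < c)%N -> E <= c%:R -> eps + del <= 8^-1 ->
  (4 * c.+1)%:R / 2 ^+ m <= del ->
  (2 ^ (1 + 8 * c ^ 2 * (1 + m)) <= #|I|)%N ->
  (forall x, normsq (u x) <= c%:R) -> (forall i, normsq (v i) = E) ->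
  (forall x i, `|redot (u x) (v i) - (F x i)%:~R| <= eps) ->
  (forall i j, i != j -> exists x, F x i != F x j) ->
  (forall i, F x0 i != 0) ->
  exists w i0, [/\
    forall x, exists k : int, `|redot (u x) w - k%:~R| <= eps + del,
    normsq w <= E - (32 * c%:R)^-1 & normsq (v i0 - w) <= E - (32 * c%:R)^-1].
Proof.
move=> c0 Ec ed8 hdel cI uc vE Feps Fsep F0.
have c0R : 1 <= c%:R :> R by rewrite ler1n.
have cp : 0 < c%:R :> R by rewrite ltr0n.
have del0 : 0 <= del.
  by apply: le_trans hdel; rewrite divr_ge0 // exprn_ge0.
have vc i : normsq (v i) <= c%:R by rewrite vE.
have [A [A1 conc]] := concentrated_subset c0 vc cI.
have A0 : (0 < #|A|)%N by exact: ltnW.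
have FK x i : `|F x i| <= (c.+1)%:Z.
  by apply: (near_int_bound (uc x) (vc i)); have := Feps x i; lra.
set w := average v A.
have near x : exists2 i0, i0 \in A & `|redot (u x) w - (F x i0)%:~R| <= eps + del.
  have eps8 : eps <= 8^-1 by lra.
  have [i0 i0A h] :=
    average_almost_integer A0 (uc x) eps8 conc (Feps x) (FK x).
  by exists i0 => //; apply: le_trans h _; rewrite lerD2l.
have spE := spreadE A0 vE; rewrite -/w in spE.
have AR : 0 < #|A|%:R :> R by rewrite ltr0n.
have inv32 : (32 * c%:R)^-1 = 32^-1 / c%:R :> R by rewrite invfM.
have [a aA] := card_gt0P A0.
case: (@Order.TotalTheory.arg_minP _ _ _ a (fun i => i \in A)
  (fun i => normsq (v i - w)) aA) => i0 i0A i0min.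
rewrite /= in i0min.
have hmin : #|A|%:R * normsq (v i0 - w) <= spread v A.
  by rewrite mulr_natl -sumr_const; apply: ler_sum.
(* Distinct integers with errors at most 1/8 leave a difference of 3/4 along some [u x], and
   [9/16 >= 8/32]. *)
have sep i : i \in A -> i != i0 -> 32^-1 / c%:R * 8 <= normsq (v i - v i0).
  move=> iA ii0; have [x Fx] := Fsep _ _ ii0.
  have h1 := Feps x i; have h2 := Feps x i0.
  have h3 : 1 <= `|(F x i)%:~R - (F x i0)%:~R| :> R.
    by rewrite -intrB -intr_norm ler1z -gtz0_ge1 normr_gt0 subr_eq0.
  have h4 : 3 / 4 <= `|redot (u x) (v i - v i0)|.
    rewrite redotDr redotNr.
    move: h1 h2 h3; rewrite !ler_norml ler_normr => /andP[? ?] /andP[? ?] /orP[|] h3.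
      rewrite ler_normr; apply/orP; left; lra.
    rewrite ler_normr; apply/orP; right; lra.
  have h5 : (3 / 4) ^+ 2 <= redot (u x) (v i - v i0) ^+ 2.
    by rewrite -[leRHS]real_normK ?num_real // ler_sqr ?nnegrE; lra.
  have h6 := redot_sqr_le (u x) (v i - v i0).
  have h7 := ler_wpM2r (normsq_ge0 (v i - v i0)) (uc x).
  rewrite -(ler_pM2l cp) (_ : c%:R * _ = 8 / 32);
      last by field; rewrite lt0r_neq0.
  lra.
(* The parallel axis identity at [v i0]: both of its terms are at most the spread, by the choice of
   [i0]. *)
have hvar : (#|A|%:R - 1) * (32^-1 / c%:R * 8) <= 2 * spread v A.
  have := sum_normsqB v (v i0) A0; rewrite -/w -normsqN opprB => hh.
  have : (#|A|%:R - 1) * (32^-1 / c%:R * 8) <= \sum_(i in A) normsq (v i - v i0).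
    rewrite (bigD1 i0) //=.
    have -> : #|A|%:R - 1 = \sum_(i in A | i != i0) 1 :> R.
      rewrite (cardD1 i0 A) i0A natrD [1 + _]addrC addrK -sum1_card natr_sum.
      by apply: eq_bigl => i; rewrite !inE andbC.
    rewrite mulr_suml.
    apply: le_trans (_ : \sum_(i in A | i != i0) normsq (v i - v i0) <= _).
      by apply: ler_sum => i /andP[iA ii0]; rewrite mul1r; exact: sep.
    by rewrite lerDr normsq_ge0.
  lra.
exists w, i0; split.
- by move=> x; have [i _ ?] := near x; exists (F x i).
- have A2 : 2 <= #|A|%:R :> R by rewrite ler_nat.
  have : 0 < 32^-1 / c%:R :> R by rewrite divr_gt0.
  rewrite inv32; set d := _ / _ in hvar * => dp.
  rewrite -(ler_pM2l AR); have := ler_wpM2r (ltW dp) A2; lra.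
(* The closest index is within the mean squared distance [spread v A / #|A| = E - normsq w], so a
   lower bound on [normsq w] suffices. *)
- have [i iA hi] := near x0.
  have h1 : 7 / 8 <= `|redot (u x0) w|.
    have : 1 <= `|(F x0 i)%:~R : R| by rewrite -intr_norm ler1z -gtz0_ge1 normr_gt0.
    rewrite distrC in hi.
    have := ler_normD ((F x0 i)%:~R - redot (u x0) w) (redot (u x0) w).
    rewrite subrK; lra.
  have h2 : (7 / 8) ^+ 2 <= redot (u x0) w ^+ 2.
    by rewrite -[leRHS]real_normK ?num_real // ler_sqr ?nnegrE; lra.
  have h3 := redot_sqr_le (u x0) w.
  have h4 := ler_wpM2r (normsq_ge0 w) (uc x0).
  have h5 : (32 * c%:R)^-1 <= normsq w.
    rewrite inv32 -(ler_pM2l cp) (_ : c%:R * _ = 32^-1);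
      last by field; rewrite lt0r_neq0.
    lra.
  have : normsq (v i0 - w) <= E - normsq w by rewrite -(ler_pM2l AR) -spE.
  lra.
Qed.

End Splitting.

(** * Signed sums of open cosets *)

Section CosetSums.
Variable G : topologicalGroupType.
Implicit Types (F : G -> int) (H : set G).

(** The index counts terms with repetition, so it is the number [L] to be bounded. *)
Inductive coset_sum : nat -> (G -> int) -> Prop :=
| coset_sum0 : coset_sum 0 (fun=> 0)
| coset_sumS n F a H (s : int) : subgroup H -> open H -> s = 1 \/ s = -1 ->
    coset_sum n F -> coset_sum n.+1 (fun g => s * \1_(left_coset a H) g + F g).

Lemma coset_sumD n1 n2 F1 F2 : coset_sum n1 F1 -> coset_sum n2 F2 ->
  coset_sum (n1 + n2) (fun g => F1 g + F2 g).
Proof.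
move=> h1 h2; elim: h1 => [|n F a H s sH oH hs _ ih].
  by rewrite add0n (_ : (fun _ => _) = F2) //; apply/funext => g; rewrite add0r.
rewrite addSn (_ : (fun _ => _) =
  (fun g => s * \1_(left_coset a H) g + (F g + F2 g))).
  exact: coset_sumS.
by apply/funext => g; rewrite addrA.
Qed.

Lemma left_cosetE a H g : left_coset a H g <-> H (a^-1 * g)%g.
Proof.
split=> [[h hH <-]|hg]; first by rewrite mulKg.
by exists (a^-1 * g)%g; rewrite ?mulVKg.
Qed.

(** Translation moves [a H] to [y^-1 a H], with the same subgroup and sign. *)
Lemma coset_sum_translate n F y :
  coset_sum n F -> coset_sum n (fun g => F (y * g)%g).
Proof.
elim=> [|m {}F a H s sH oH hs _ ih]; first exact: coset_sum0.
rewrite (_ : (fun _ => _) =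
  (fun g => s * \1_(left_coset (y^-1 * a)%g H) g + F (y * g)%g)).
  exact: coset_sumS.
apply/funext => g; congr (_ * _ + _); rewrite !indicE.
have e : left_coset a H (y * g)%g <-> left_coset (y^-1 * a)%g H g.
  by rewrite !left_cosetE invgM invgK mulgA.
by congr (nat_of_bool _)%:R; apply/idP/idP; rewrite !inE => /e.
Qed.

Lemma coset_sum_mulrz n F (z : int) H a : subgroup H -> open H ->
  coset_sum n F ->
  coset_sum (`|z| + n) (fun g => z * \1_(left_coset a H) g + F g).
Proof.
move=> sH oH hF.
have [s hs zE] : exists2 s : int, s = 1 \/ s = -1 & z = s * `|z|%N.
  case: z => k; first by exists 1; [left|rewrite mul1r].
  by exists (-1); [right|rewrite mulN1r NegzE].
rewrite [in X in coset_sum _ X]zE; elim: `|z|%N => [|k ih].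
  rewrite add0n (_ : (fun _ => _) = F) //.
  by apply/funext => g; rewrite mulr0 mul0r add0r.
rewrite addSn (_ : (fun _ => _) = (fun g =>
  s * \1_(left_coset a H) g + (s * k%:Z * \1_(left_coset a H) g + F g))).
  exact: coset_sumS.
by apply/funext => g; rewrite -addn1 PoszD mulrDr mulr1; ring.
Qed.

Lemma open_conj H y : open H -> open [set g | H (y * g * y^-1)%g].
Proof.
move=> oH; apply: (@open_comp _ _ (fun g => y * g * y^-1)%g) => // g _.
have cst (z : G) : {for g, continuous (fun=> z)} by exact: cst_continuous.
have mul (f1 f2 : G -> G) : {for g, continuous f1} -> {for g, continuous f2} ->
    {for g, continuous (fun x => f1 x * f2 x)%g}.
  move=> c1 c2.
  apply: (@continuous_comp _ _ _ (fun x => (f1 x, f2 x)) (fun z : G * G => z.1 * z.2)%g).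
    exact: cvg_pair.
  exact: mulg_continuous.
apply: (mul (fun x => y * x)%g (fun=> y^-1)%g) (cst _).
by apply: (mul (fun=> y) id) => //; exact: cvg_id.
Qed.

Lemma subgroup_conj H y : subgroup H -> subgroup [set g | H (y * g * y^-1)%g].
Proof.
move=> [h1 hD]; split; first by rewrite inE /= mulg1 mulgV -inE.
move=> a b; rewrite !inE /= => ha hb.
have := hD (y * a * y^-1)%g (y * b * y^-1)%g; rewrite !inE => /(_ ha hb).
by rewrite !invgM invgK !mulgA mulgVK.
Qed.

(* The right coset [H y] is the left coset of a conjugate of [H]. *)
Lemma coset_sum_finite_support F H (K : nat) (ys : seq G) :
  subgroup H -> open H ->
  (forall h g, H h -> F (h * g)%g = F g) -> (forall g, (`|F g| <= K)%N) ->
  (forall g, F g != 0 -> exists2 y, y \in ys & H (g * y^-1)%g) ->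
  exists2 L, (L <= size ys * K)%N & coset_sum L F.
Proof.
move=> sH oH; elim: ys F => [|y ys ih] F Finv FK Fsupp.
  exists 0%N => //; rewrite (_ : F = fun=> 0); first exact: coset_sum0.
  by apply/funext => g; apply/eqP/negPn/negP => /Fsupp[].
have [h1 hD] := sH.
have hV h : H h -> H h^-1%g.
  by move=> hh; have := hD 1%g h h1; rewrite !inE div1g; apply.
have hM a b : H a -> H b -> H (a * b)%g.
  move=> ha hb; have := hD a b^-1%g; rewrite !inE invgK; apply => //; exact: hV.
pose B := [set g | H (g * y^-1)%g].
have BH h g : H h -> B (h * g)%g <-> B g.
  move=> hh; rewrite /B /= -mulgA; split=> [hb|]; last exact: hM.
  by rewrite -(mulKg h (g * y^-1)%g); apply: hM => //; exact: hV.
(* Peel off the right coset [B], on which [F] is constantly [F y]. What remains is still invariant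
   and is supported on the cosets of [ys]. *)
pose F' g : int := if `[< B g >] then 0 else F g.
have [|||L LK hL] := ih F'.
- move=> h g hh; rewrite /F' Finv //.
  by congr (if _ then _ else _); apply: asbool_equiv_eq; exact: BH.
- by move=> g; rewrite /F'; case: ifP.
- move=> g; rewrite /F'; case: asboolP => //= nB /Fsupp[z].
  by rewrite inE => /orP[/eqP -> //|zys hz]; exists z.
exists (`|F y| + L)%N; first by rewrite /= mulSn leq_add.
have FE : F = (fun g => F y *
    \1_(left_coset y [set g | H (y * g * y^-1)%g]) g + F' g).
  apply/funext => g; rewrite indicE /F'.
  have e : left_coset y [set g | H (y * g * y^-1)%g] g <-> B g.
    by rewrite left_cosetE /= mulVKg.
  case: asboolP => Bg.
    rewrite mem_set; last exact/e.
    by rewrite mulr1 addr0 -(Finv _ y Bg) mulgVK.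
  rewrite memNset; last by move/e.
  by rewrite mulr0 add0r.
rewrite [X in coset_sum _ X]FE.
apply: coset_sum_mulrz => //; [exact: subgroup_conj|exact: open_conj].
Qed.

Lemma coset_sum_family (R : realType) n F : coset_sum n F ->
  exists (H : 'I_n -> set G) (a : 'I_n -> G) (sigma : 'I_n -> int),
    [/\ forall i, subgroup (H i) /\ open (H i),
        forall i, sigma i = 1 \/ sigma i = -1 &
        forall g, (F g)%:~R = \sum_(i < n) (sigma i)%:~R *
          \1_(left_coset (a i) (H i)) g :> R[i]].
Proof.
elim=> [|m {}F a H s sH oH hs _ [Hs [as_ [ss [h1 h2 h3]]]]].
  exists (fun=> setT), (fun=> 1%g), (fun=> 1); split=> [[]//|[]//|g].
  by rewrite big_ord0.
pose cons T (x : T) f (i : 'I_m.+1) : T := oapp f x (unlift ord0 i).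
exists (cons _ H Hs), (cons _ a as_), (cons _ s ss); split.
- by move=> i; rewrite /cons; case: (unlift ord0 i) => [j|] /=; [exact: h1|].
- by move=> i; rewrite /cons; case: (unlift ord0 i) => [j|] /=; [exact: h2|].
move=> g; rewrite big_ord_recl /cons unlift_none /= intrD intrM h3.
congr (_ * _ + _).
  by rewrite !indicE; case: (_ \in _).
by apply: eq_bigr => i _; rewrite liftK.
Qed.

(** Greedy selection: as long as the chosen points do not cover [P], an uncovered point can be
    appended. *)
Lemma separated_or_covered (P : set G) (E : G -> G -> Prop) (N : nat) :
  (exists y : nat -> G, forall i, (i < N)%N -> P (y i) /\
     forall j, (j < i)%N -> ~ E (y i) (y j)) \/
  (exists2 ys, (size ys <= N)%N & forall g, P g -> exists2 y, y \in ys & E g y).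
Proof.
elim: N => [|N [[y hy]|[ys sz hys]]]; first by left; exists (fun=> 1%g).
- have [[g [Pg hg]]|none] :=
    pselect (exists g, P g /\ forall j, (j < N)%N -> ~ E g (y j)).
    left; exists (fun i => if i == N then g else y i) => i.
    rewrite ltnS leq_eqVlt => /orP[/eqP -> |iN].
      by rewrite eqxx; split=> // j jN; rewrite ltn_eqF //; exact: hg.
    rewrite ltn_eqF //; have [Pi hi] := hy _ iN; split=> // j ji.
    by rewrite ltn_eqF ?(ltn_trans ji) //; exact: hi.
  right; exists [seq y i | i <- iota 0 N]; first by rewrite size_map size_iota.
  move=> g Pg; apply: contrapT => hg; apply: none; exists g; split=> // j jN Ej.
  by apply: hg; exists (y j) => //; rewrite map_f // mem_iota.
- by right; exists ys => //; exact: leqW.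
Qed.

End CosetSums.

Lemma intr_norm_lt1 (R : realType) (k : int) : `|k%:~R : R| < 1 -> k = 0.
Proof.
rewrite -intr_norm (ltr_int R _ 1) => k1; apply: contraTeq k1 => k0.
by rewrite -leNgt -gtz0_ge1 normr_gt0.
Qed.

(** * The induction on the norm of the second vector *)

Section Representation.
Variables (R : realType) (G : topologicalGroupType) (H : hilbertType R).
Variables (pi : G -> {linear H -> H}) (pi_rep : unitary_rep pi).

Lemma redot_rep g (x y : H) : redot (pi g x) y = redot x (pi g^-1%g y).
Proof.
rewrite /redot -(rep_inner pi_rep g x) -(repM pi_rep) mulgV.
by rewrite (rep1 pi_rep).
Qed.

Lemma normsq_rep g (x : H) : normsq (pi g x) = normsq x.
Proof. by rewrite /normsq /redot (rep_inner pi_rep). Qed.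

(** Left translations are used, so [F] is constant on right cosets of this group. *)
Definition stabilizer (F : G -> int) : set G :=
  [set h | forall g, F (h * g)%g = F g].

Lemma subgroup_stabilizer F : subgroup (stabilizer F).
Proof.
split; first by rewrite inE => g; rewrite mul1g.
move=> a b; rewrite !inE => ha hb g.
by rewrite -mulgA ha -[in RHS](mulVKg b g) hb.
Qed.

Variables (xi : H) (c : nat).
Hypotheses (c0 : (0 < c)%N) (xic : normsq xi <= c%:R).

(** By strong continuity, [h] near [h0] moves the coefficient by at most 1/2, uniformly in [g]. With
    two errors of 1/8 the integers [F (h * g)] and [F (h0 * g)] differ by at most 3/4, hence
    agree. *)
Lemma open_stabilizer (eta : H) (F : G -> int) :
  (forall g, `|redot (pi g xi) eta - (F g)%:~R| <= 8^-1) ->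
  open (stabilizer F).
Proof.
move=> hF; rewrite openE => h0 hh0.
have cp : 1 <= c%:R :> R by rewrite ler1n.
pose e : R := (2 * c%:R)^-1.
have e0 : 0 < e by rewrite invr_gt0; lra.
have cont : (fun h => pi h^-1%g eta) @ h0 --> pi h0^-1%g eta.
  apply: (@continuous_comp _ _ _ (fun h : G => h^-1%g) (fun g => pi g eta)).
    exact: invg_continuous.
  exact: rep_strong.
have e0C : 0 < e%:C by rewrite ltcR.
move/cvgrPdist_lt/(_ _ e0C): cont; apply: filterS => h hh g.
rewrite -(hh0 g).
set d := pi h0^-1%g eta - pi h^-1%g eta in hh.
have dn : normsq d <= e ^+ 2.
  rewrite -lecR normsq_norm rmorphXn /=.
  by apply: lerXn2r; rewrite ?nnegrE ?normr_ge0 ?(ltW e0C) // ltW.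
have -> : F (h * g)%g = F (h0 * g)%g; last by [].
have := hF (h * g)%g; have := hF (h0 * g)%g.
rewrite !(repM pi_rep) !(redot_rep _ (pi g xi)).
set a := redot _ _; set b := redot _ _ => h1 h2.
have ab : (a - b) ^+ 2 <= 2^-1 ^+ 2.
  have -> : a - b = redot (pi g xi) d by rewrite redotDr redotNr.
  apply: le_trans (redot_sqr_le _ _) _; rewrite normsq_rep.
  apply: (@le_trans _ _ (c%:R * e ^+ 2)).
    by apply: ler_pM => //; exact: normsq_ge0.
  have -> : c%:R * e ^+ 2 = e / 2 by rewrite /e; field; rewrite lt0r_neq0 //; lra.
  rewrite (_ : 2^-1 ^+ 2 = 2^-1 / 2); last by field.
  rewrite ler_wpM2r // /e lef_pV2 ?posrE //; lra.
have {}ab : `|a - b| <= 2^-1.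
  by rewrite -(@ler_pXn2r _ 2) ?nnegrE // real_normK ?num_real.
apply/eqP; rewrite -subr_eq0; apply/eqP/(@intr_norm_lt1 R); rewrite intrB.
move: h1 h2 ab; rewrite !ler_norml ltr_norml.
by move=> /andP[? ?] /andP[? ?] /andP[? ?]; apply/andP; split; lra.
Qed.

(** Only [n] is inducted on; [n0] stays fixed, so that [m], [N] and [del] do not change. A split
    lowers [32 c * normsq eta] by 1 and doubles [eps + del], which keeps [(eps + del) * 2^n]
    constant; the two halves account for the factor [2 ^ n]. *)
Lemma coset_decomposition (n0 n : nat) (eta : H) (eps : R) (F : G -> int) :
  let m := (n0 + 6 + c)%N in
  let N := (2 ^ (1 + 8 * c ^ 2 * (1 + m)))%N in
  let del : R := (2 ^+ (n0 + 4))^-1 in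
  normsq eta <= c%:R -> 32 * c%:R * normsq eta <= n%:R ->
  (forall g, `|redot (pi g xi) eta - (F g)%:~R| <= eps) ->
  (eps + del) * 2 ^+ n <= 8^-1 ->
  exists2 L, (L <= 2 ^ n * (N * c.+1))%N & coset_sum L F.
Proof.
move=> m N del.
have cp : 1 <= c%:R :> R by rewrite ler1n.
have cR : 0 < c%:R :> R by rewrite ltr0n.
have del0 : 0 < del by rewrite invr_gt0 exprn_gt0.
(* The [6 + c] in [m] exceeds the 4 in [del] by [2 + c], and [4 * (c + 1) <= 2 ^ (2 + c)]. *)
have delm : (4 * c.+1)%:R / 2 ^+ m <= del.
  rewrite /m (_ : n0 + 6 + c = n0 + 4 + (2 + c))%N; last by lia.
  rewrite exprD invfM mulrCA ler_piMr ?(ltW del0) //.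
  rewrite ler_pdivrMr ?exprn_gt0 // mul1r -natrX ler_nat expnD leq_mul2l /=.
  exact: ltn_expl.
elim: n eta eps F => [|n ih] eta eps F etac etan Feps epsn.
  exists 0%N => //; rewrite (_ : F = fun=> 0); first exact: coset_sum0.
  apply/funext => g.
  have eta0 : normsq eta = 0.
    apply/eqP; rewrite eq_le normsq_ge0 andbT.
    by rewrite -(pmulr_rle0 _ (_ : 0 < 32 * c%:R)) ?mulr_gt0.
  have := redot_sqr_le (pi g xi) eta; rewrite eta0 mulr0 => h.
  have h' : redot (pi g xi) eta = 0.
    by apply/eqP; rewrite -sqrf_eq0 eq_le h sqr_ge0.
  have := Feps g; rewrite h' sub0r normrN expr0 mulr1 in epsn * => h1.
  by apply: (@intr_norm_lt1 R); lra.
have pow1 : 1 <= 2 ^+ n :> R by rewrite exprn_ege1 // ler1n.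
have eps0 : 0 <= eps by exact: le_trans (normr_ge0 _) (Feps 1%g).
have ed8 : eps + del <= 8^-1.
  apply: le_trans epsn; rewrite ler_peMr ?exprn_ege1 ?ler1n //; lra.
have xigc g : normsq (pi g xi) <= c%:R by rewrite normsq_rep.
have FK g : (`|F g| <= c.+1)%N.
  rewrite -lez_nat; apply: (near_int_bound (xigc g) etac).
  by have := Feps g; lra.
have sS := subgroup_stabilizer F.
have oS : open (stabilizer F).
  by apply: (@open_stabilizer eta) => g; apply: le_trans (Feps g) _; lra.
(* If at most [N] right cosets of the stabilizer cover the support, the sum is written down
   directly; otherwise [N] inequivalent points feed the splitting. *)
have [[y hy]|[ys sz hys]] := @separated_or_covered G [set g | F g != 0]
    (fun g h => stabilizer F (g * h^-1)%g) N; last first.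
  have [L LN hL] := coset_sum_finite_support sS oS
    (fun h g hh => hh g) FK hys.
  exists L => //; apply: leq_trans LN _.
  by apply: leq_trans (leq_pmull _ _); rewrite ?expn_gt0 // leq_mul2r sz orbT.
pose v (i : 'I_N) := pi (y i)^-1%g eta.
pose F2 x (i : 'I_N) := F (y i * x)%g.
have vE i : normsq (v i) = normsq eta by rewrite normsq_rep.
have F2eps x i : `|redot (pi x xi) (v i) - (F2 x i)%:~R| <= eps.
  by rewrite -redot_rep -(repM pi_rep).
have sepF (i j : 'I_N) : (j < i)%N -> exists x, F2 x i != F2 x j.
  move=> ji; have [_ /(_ _ ji) nS] := hy i (ltn_ord i).
  apply: contrapT => none; apply: nS => g; rewrite -mulgA.
  (* If [F (y i * x) = F (y j * x)] for all [x], then [y i * (y j)^-1] would stabilize [F]; the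
     substitution is [x = (y j)^-1 * g]. *)
  apply/eqP/negPn/negP => neq; apply: none; exists ((y j)^-1 * g)%g.
  by rewrite /F2 mulVKg.
have sep2 (i j : 'I_N) : i != j -> exists x, F2 x i != F2 x j.
  rewrite -(inj_eq val_inj) neq_ltn => /orP[ij|]; last exact: sepF.
  by have [x hx] := sepF _ _ ij; exists x; rewrite eq_sym.
have F20 i : F2 1%g i != 0.
  by rewrite /F2 mulg1; have [] := hy i (ltn_ord i).
have cN : (2 ^ (1 + 8 * c ^ 2 * (1 + m)) <= #|'I_N|)%N by rewrite card_ord.
have [w [i0 [hw wn en]]] := splitting_vector c0 etac ed8 delm cN
  xigc vE F2eps sep2 F20.
have [Fw hFw] := choice hw.
have inv0 : 0 < (32 * c%:R)^-1 :> R by rewrite invr_gt0 mulr_gt0.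
have step (z : H) : normsq z <= normsq eta - (32 * c%:R)^-1 ->
    normsq z <= c%:R /\ 32 * c%:R * normsq z <= n%:R.
  move=> hz; split; first by lra.
  have := ler_wpM2l (ltW (mulr_gt0 (ltr0n _ 32) cR)) hz.
  rewrite mulrBr divff ?mulf_neq0 ?lt0r_neq0 // -natr1 in etan *; lra.
have [wc wn'] := step w wn; have [ec en'] := step _ en.
(* The error is [eps + del] for [w], and a further [eps] for [v i0 - w]. *)
pose eps2 := 2 * eps + del.
have eps2n : (eps2 + del) * 2 ^+ n <= 8^-1.
  by apply: le_trans epsn; rewrite /eps2 exprS; lra.
have [|L1 L1N h1] := ih w eps2 Fw wc wn' _ eps2n.
  by move=> g; apply: le_trans (hFw g) _; rewrite /eps2; lra.
have [|L2 L2N h2] := ih _ eps2 (fun x => F2 x i0 - Fw x) ec en' _ eps2n.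
  move=> g; rewrite redotDr redotNr intrB.
  set a := redot _ _; set b := redot _ _.
  have -> : a - b - ((F2 g i0)%:~R - (Fw g)%:~R) =
    (a - (F2 g i0)%:~R) - (b - (Fw g)%:~R) by ring.
  apply: le_trans (ler_normB _ _) _.
  by have := F2eps g i0; have := hFw g; rewrite -/a -/b /eps2; lra.
exists (L1 + L2)%N.
  by rewrite expnS -mulnA mul2n -addnn leq_add.
(* The two summands add up to [F (y i0 * x)]; translating back recovers [F]. *)
have := coset_sum_translate (y i0)^-1%g (coset_sumD h1 h2).
congr (coset_sum _ _); apply/funext => g.
by rewrite addrC subrK /F2 mulVKg.
Qed.

End Representation.

(** * The final bound *)

Lemma decomposition_exponent (c L : nat) : (0 < c)%N ->
  let n := (32 * c ^ 2)%N in
  (L <= 2 ^ n * (2 ^ (1 + 8 * c ^ 2 * (1 + (n + 6 + c))) * c.+1))%N ->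
  (L <= 2 ^ (354 * c ^ 4))%N.
Proof.
move=> c0 n h; apply: leq_trans h _.
apply: (@leq_trans (2 ^ n * (2 ^ (1 + 8 * c ^ 2 * (1 + (n + 6 + c))) * 2 ^ c))).
  by rewrite !leq_mul2l (ltn_expl c (leqnn 2)) !orbT.
rewrite -!expnD leq_exp2l // /n.
have -> : (c ^ 4 = c ^ 2 * c ^ 2)%N by rewrite -expnD.
have : (c <= c ^ 2)%N by rewrite -{1}(expn1 c) leq_pexp2l.
move: (c ^ 2)%N => d cd.
have d1 : (1 <= d)%N := leq_trans c0 cd.
have dc : (d * c <= d * d)%N by rewrite leq_mul2l cd orbT.
have dd : (d <= d * d)%N by rewrite leq_pmull.
(* With [d = c^2] the exponent is [32 d + 1 + 8 d (7 + 32 d + c) + c], at most [(32 + 1 + 56 + 256 +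
   8 + 1) d^2 = 354 d^2]. *)
lia.
Qed.

Lemma representation_of_norm_lt (R : realType) (G : topologicalGroupType)
    (f : G -> R[i]) (gamma r : R) :
  fourier_stieltjes f -> fourier_stieltjes_norm f <= gamma -> gamma < r ->
  exists (H : hilbertType R) (pi : G -> {linear H -> H}) (xi eta : H) (s : R),
    [/\ unitary_rep pi, forall g, f g = inner (pi g xi) eta, 0 <= s, s < r &
        s ^+ 2 = normsq xi * normsq eta].
Proof.
move=> [H [pi [xi [eta [pi_rep fE]]]]] fg gr.
have normsE (K : hilbertType R) (x y : K) s : s%:C = `|x| * `|y| ->
    0 <= s /\ s ^+ 2 = normsq x * normsq y.
  move=> sE; split; first by rewrite -lecR sE mulr_ge0.
  apply: (@complexI R).
  by rewrite rmorphXn rmorphM /= sE exprMn !normsq_norm.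
have inf_norms : has_inf (coefficient_norms f).
  split; last first.
    by exists 0 => s [K [rho [x [y [_ _ /normsE[]]]]]].
  exists (complex.Re (`|xi| * `|eta|)), H, pi, xi, eta; split=> //.
  have : 0 <= `|xi| * `|eta| by rewrite mulr_ge0.
  by case: (`|xi| * `|eta|) => a b; rewrite lecE /= => /andP[/eqP -> _].
have rg : 0 < r - fourier_stieltjes_norm f by lra.
have [s [K [rho [x [y [rho_rep fE' sE]]]]] sr] := inf_adherent rg inf_norms.
have [s0 s2] := normsE _ _ _ _ sE.
exists K, rho, x, y, s; split=> //.
by move: sr; rewrite /fourier_stieltjes_norm; lra.
Qed.

Theorem theorem1p6 (R : realType) :
  exists2 C : R, 0 < C &
    forall (G : topologicalGroupType) (f : G -> R[i]) (gamma : R),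
      locally_compact [set: G] ->
      fourier_stieltjes f ->
      (forall g, exists n : int, f g = n%:~R) ->
      fourier_stieltjes_norm f <= gamma ->
      exists (L : nat) (H : 'I_L -> set G) (a : 'I_L -> G) (sigma : 'I_L -> int),
        [/\ forall i, subgroup (H i) /\ open (H i),
            forall i, sigma i = 1 \/ sigma i = -1,
            forall g, f g = \sum_(i < L) (sigma i)%:~R * \1_(left_coset (a i) (H i)) g &
            L%:R <= 2 `^ (C * gamma ^+ 4)].
Proof.
(* The constant is [354 * 2^4], from the exponent [354 c^4] and [c <= 2 gamma]. *)
exists 5664; first by rewrite ltr0n.
move=> G f gamma _ fFS fint fgamma.
have [F hF] := choice fint.
suff [L hL LE] : exists2 L : nat, coset_sum L F &
    L%:R <= 2 `^ (5664 * gamma ^+ 4) :> R.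
  have [H [a [sigma [h1 h2 h3]]]] := coset_sum_family R hL.
  by exists L, H, a, sigma; split=> // g; rewrite hF h3.
have redotF (H : hilbertType R) (x y : H) g : f g = inner x y ->
    redot x y = (F g)%:~R.
  by rewrite /redot => <-; rewrite hF -(rmorph_int (real_complex R)).
have zero : (forall g, F g = 0) -> exists2 L : nat, coset_sum L F &
    L%:R <= 2 `^ (5664 * gamma ^+ 4) :> R.
  move=> F0; exists 0%N; last exact: powR_ge0.
  by rewrite (_ : F = fun=> 0); [exact: coset_sum0|exact/funext].
have small (H : hilbertType R) (pi : G -> {linear H -> H}) (xi eta : H) :
    unitary_rep pi -> (forall g, f g = inner (pi g xi) eta) ->
    normsq xi * normsq eta < 1 -> forall g, F g = 0.
  move=> pi_rep fE lt1 g; apply: (@intr_norm_lt1 R); rewrite -(redotF _ _ _ _ (fE g)).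
  rewrite -(@ltr_pXn2r _ 2) ?nnegrE // expr1n real_normK ?num_real //.
  by apply: le_lt_trans (redot_sqr_le _ _) _; rewrite (normsq_rep pi_rep).
(* Below norm 1 an integer-valued coefficient vanishes, and the empty sum serves. *)
have [gamma1|gamma1] := ltP gamma 1.
  have [H [pi [xi [eta [s [pi_rep fE s0 s1 sE]]]]]] :=
    representation_of_norm_lt fFS fgamma gamma1.
  apply/zero/(small _ _ _ _ pi_rep fE); rewrite -sE.
  by rewrite expr_lt1.
(* [c] strictly exceeds [gamma], so some representation has norm product below [c] even if the
   infimum is not attained. *)
pose c := (Num.truncn gamma).+1.
have /andP[cg gc] : (Num.truncn gamma)%:R <= gamma < c%:R.
  by apply: truncn_itv; lra.
have c0 : (0 < c)%N by [].
have c1 : 1 <= c%:R :> R by rewrite ler1n.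
have c2 : c%:R <= 2 * gamma by rewrite /c -natr1; lra.
have [H [pi [xi [eta [s [pi_rep fE s0 sc sE]]]]]] :=
  representation_of_norm_lt fFS fgamma gc.
have [xi0|xi0] := eqVneq (normsq xi) 0.
  by apply/zero/(small _ _ _ _ pi_rep fE); rewrite xi0 mul0r.
have xip : 0 < normsq xi by rewrite lt_def xi0 normsq_ge0.
(* Rescaling [xi] by [t] and [eta] by [t^-1] keeps the coefficient and balances the vectors: squared
   norms [c] and [s^2 / c <= c]. *)
pose t := Num.sqrt (c%:R / normsq xi).
have t2 : t ^+ 2 = c%:R / normsq xi by rewrite sqr_sqrtr // divr_ge0 // ltW.
have tp : 0 < t by rewrite sqrtr_gt0 divr_gt0 //; lra.
have eta2 : normsq (rscale t^-1 eta) = s ^+ 2 / c%:R.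
  by rewrite normsqZ exprVn t2 invf_div mulrAC sE.
pose n := (32 * c ^ 2)%N.
have [|||||L LN hL] := @coset_decomposition R G H pi pi_rep (rscale t xi) c c0 _
    n n (rscale t^-1 eta) 0 F.
- by rewrite normsqZ t2 divfK.
- rewrite eta2 ler_pdivrMr; last by lra.
  by rewrite -expr2 lerXn2r ?nnegrE // ltW.
- rewrite eta2 /n natrM natrX.
  have -> : 32 * c%:R * (s ^+ 2 / c%:R) = 32 * s ^+ 2 :> R.
    by field; rewrite lt0r_neq0 //; lra.
  by rewrite ler_wpM2l // lerXn2r ?nnegrE // ltW.
- move=> g; rewrite /rscale linearZ /= -!/(rscale _ _) redotZl redotZr.
  by rewrite mulrA divff ?lt0r_neq0 // mul1r (redotF _ _ _ _ (fE g)) subrr normr0.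
(* Initially [eps = 0], and [del * 2^n = 1/16]. *)
- rewrite add0r exprD invfM mulrAC mulVf ?mul1r ?lt0r_neq0 ?exprn_gt0 //.
  by rewrite -natrX lef_pV2 ?posrE // ler_nat.
exists L => //.
have {}LN := decomposition_exponent c0 LN.
apply: (@le_trans _ _ (2 ^+ (354 * c ^ 4))).
  by rewrite -natrX ler_nat.
rewrite -[2 ^+ _]powR_mulrn //; apply: ler_powR; first by rewrite ler1n.
rewrite natrM natrX.
have : c%:R ^+ 4 <= (2 * gamma) ^+ 4 by rewrite lerXn2r ?nnegrE //; lra.
rewrite exprMn; lra.
Qed.
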